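(* Let $R$ be a finite Frobenius ring, let $V=R^n$, and let $G$ be a finite permutation group on the coordinates of $V$. Let $H$ be a subgroup of $G$ with $t$ orbits on the coordinates such that $|H|$ has an inverse in $R$. Let $0\le d\le t$ and $f\in\mathrm{Harm}_d(t)$. Let $C$ be a left $G$-code of length $n$ over $R$. Then, for $D=C\theta_H$ and for $D=((C^{\perp})\theta_H)M_H$, one has $$W^{H}_{D,f}(x,y) = (xy)^d\, Z^{H}_{D,f}(x,y),$$ where $Z^{H}_{D,f}$ is a homogeneous polynomial of degree $t-2d$, and these polynomials satisfy $$Z^{H}_{((C^{\perp})\theta_H)M_H,\,f}(x,y) = (-1)^d\,\frac{|R|^d}{|C\theta_H|}\, Z^{H}_{C\theta_H,f}\bigl(x+(|R|-1)y,\;x-y\bigr),$$ where $M_H$ is the $H$-orbit length matrix.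
   Context: A finite (associative, unital) ring $R$ is Frobenius if $R/\mathrm{Rad}(R)\cong \mathrm{Soc}(R_R)$ as right $R$-modules and $R/\mathrm{Rad}(R)\cong\mathrm{Soc}({}_RR)$ as left $R$-modules. $R$ need not be commutative. On $V=R^n$ put $(u,v):=u_1v_1+\cdots+u_nv_n$. A permutation group $G$ on $\{1,\dots,n\}$ acts on $V$ on the right by $(vg)_i = v_{ig^{-1}}$. A left $G$-code is a left $R$-submodule $C$ of $V$ with $Cg\subseteq C$ for all $g\in G$; its right dual is $C^{\perp}:=\{u\in V:(v,u)=0\text{ for all }v\in C\}$. ''$|H|$ has an inverse in $R$'' means $|H|\cdot 1_R$ is a unit. Define $v\theta_H:=\frac1{|H|}\sum_{h\in H}vh$ for $v\in V$ and $X\theta_H:=\{v\theta_H:v\in X\}$. Let $H_V(\alpha_1),\dots,H_V(\alpha_t)$ be the orbits of $H$ on $\{1,\dots,n\}$, $m_i$ the cardinality of $H_V(\alpha_i)$, and $\overline{H_V(\alpha_i)}\in V$ the vector with entry $1$ at the positions in $H_V(\alpha_i)$ and $0$ elsewhere. Every $u\in V\theta_H$ is uniquely $u=\sum_{i=1}^t u_i\overline{H_V(\alpha_i)}$ with $u_i\in R$; put $\mathrm{supp}_H(u):=\{i:u_i\neq0\}\subseteq[t]:=\{1,\dots,t\}$ and $\mathrm{wt}_H(u):=|\mathrm{supp}_H(u)|$. The $H$-orbit length matrix is $M_H:=\mathrm{diag}(\ell_1,\dots,\ell_n)$ with $\ell_j=m_i$ if $j\in H_V(\alpha_i)$; $YM_H:=\{yM_H:y\in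 Y\}$ for $Y\subseteq V$. Let $[t]_d$ be the set of $d$-element subsets of $[t]$ and $\mathbb{R}[t]_d$ the real vector space with basis $[t]_d$, an element being written $f=\sum_{z\in[t]_d}f(z)z$. Let $\gamma$ be the linear map $\mathbb{R}[t]_d\to\mathbb{R}[t]_{d-1}$ with $\gamma(z)=\sum_{y\in[t]_{d-1},\,y\subseteq z}y$ (zero if $d=0$), and $\mathrm{Harm}_d(t):=\ker(\gamma|_{\mathbb{R}[t]_d})$. For $f\in\mathbb{R}[t]_d$ and $u\in V\theta_H$ set $\widetilde f(u):=\sum f(\mathrm{supp}_H(v))$, summed over all $v\in V\theta_H$ with $\mathrm{wt}_H(v)=d$ and $\mathrm{supp}_H(v)\subseteq\mathrm{supp}_H(u)$. For a left or right $R$-submodule $D\subseteq V\theta_H$ and $f\in \mathrm{Harm}_d(t)$, the harmonic $H$-weight enumerator is $W^H_{D,f}(x,y):=\sum_{u\in D}\widetilde f(u)\,x^{t-\mathrm{wt}_H(u)}y^{\mathrm{wt}_H(u)}$. The zero polynomial is regarded as homogeneous of every degree. *)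

(* Defs.v *)
From HB Require Import structures.
From mathcomp Require Import all_boot all_order all_algebra all_fingroup.
From mathcomp Require Import reals.
From mathcomp Require Import mpoly.

Set Implicit Arguments.
Unset Strict Implicit.
Unset Printing Implicit Defensive.
Import GRing.Theory.
Local Open Scope ring_scope.

Section Frobenius.
Variable R : finNzRingType.
Implicit Types I J : {set R}.

Definition additive_subset I : bool :=
  (0 \in I) && [forall x in I, forall y in I, x - y \in I].

Definition left_ideal I : bool :=
  additive_subset I && [forall r : R, forall x in I, r * x \in I].

Definition right_ideal I : bool :=
  additive_subset I && [forall r : R, forall x in I, x * r \in I].

(* The Jacobson radical, as the intersection of the maximal left ideals. *)
Definition radical : {set R} :=
  \bigcap_(I : {set R} | maxset (fun J => left_ideal J && (J != [set: R])) I) I.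

(* The sum of the simple submodules of a module is the smallest submodule that
   contains all of them. *)
Definition socle (ideal : {set R} -> bool) : {set R} :=
  \bigcap_(J : {set R} | ideal J &&
     [forall I, minset (fun I' => ideal I' && (I' != [set 0])) I ==> (I \subset J)]) J.

Definition rad_coset (x : R) : {set R} := [set x + a | a in radical].

(* An isomorphism from R / Rad(R) is a map on the set of cosets of Rad(R). *)
Definition frobenius_right : Prop :=
  exists phi : {set R} -> R,
    [/\ {in [set rad_coset x | x in R] &, injective phi},
        phi @: [set rad_coset x | x in R] = socle right_ideal,
        forall x y,
          phi (rad_coset (x + y)) = phi (rad_coset x) + phi (rad_coset y)
      & forall x r, phi (rad_coset (x * r)) = phi (rad_coset x) * r].

Definition frobenius_left : Prop :=
  exists phi : {set R} -> R,
    [/\ {in [set rad_coset x | x in R] &, injective phi},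
        phi @: [set rad_coset x | x in R] = socle left_ideal,
        forall x y,
          phi (rad_coset (x + y)) = phi (rad_coset x) + phi (rad_coset y)
      & forall r x, phi (rad_coset (r * x)) = r * phi (rad_coset x)].

Definition frobenius_ring : Prop := frobenius_right /\ frobenius_left.

End Frobenius.

Section Codes.
Variables (R : finUnitRingType) (n : nat).
Implicit Types (u v : 'rV[R]_n) (C D : {set 'rV[R]_n}) (G H : {group 'S_n}).

Definition form u v : R := \sum_(i < n) u 0 i * v 0 i.

(* (vact v g) 0 i = v 0 (g^-1 i) *)
Definition vact v (g : 'S_n) : 'rV[R]_n := col_perm g^-1%g v.

Definition left_code G C : Prop :=
  submod_closed C /\ (forall g v, g \in G -> v \in C -> vact v g \in C).

Definition right_dual C : {set 'rV[R]_n} :=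
  [set u | [forall v in C, form v u == 0]].

(* The inverse is only meaningful when #|H|%:R is a unit of R. *)
Definition theta H v : 'rV[R]_n := #|H|%:R^-1 *: \sum_(h in H) vact v h.

Definition Vtheta H : {set 'rV[R]_n} := [set theta H v | v in 'rV[R]_n].

Definition orbit_length_mx H : 'M[R]_n :=
  diag_mx (\row_j #|orbit 'P%act H j|%:R).

End Codes.

(* alpha picks exactly one point in each orbit of H on the coordinates. *)
Definition orbit_representatives (n t : nat) (H : {group 'S_n})
    (alpha : 'I_t -> 'I_n) : Prop :=
  injective (fun i => orbit 'P%act H (alpha i)) /\
  (forall j : 'I_n, exists i : 'I_t, j \in orbit 'P%act H (alpha i)).

Section Support.
Variables (R : finUnitRingType) (n t : nat) (H : {group 'S_n}).
Variable alpha : 'I_t -> 'I_n.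

Definition orbit_vec (i : 'I_t) : 'rV[R]_n :=
  \row_j (j \in orbit 'P%act H (alpha i))%:R.

(* The coefficients of u in the orbit_vec i, which exist and are unique for
   u in Vtheta H; 0 outside Vtheta H. *)
Definition hcoef (u : 'rV[R]_n) : {ffun 'I_t -> R} :=
  odflt [ffun=> 0]
    [pick c : {ffun 'I_t -> R} | u == \sum_(i < t) c i *: orbit_vec i].

Definition hsupp (u : 'rV[R]_n) : {set 'I_t} := [set i | hcoef u i != 0].

Definition hwt (u : 'rV[R]_n) : nat := #|hsupp u|.

End Support.

Section Harmonic.
Variables (K : realType) (t : nat).

(* An element \sum_z f(z) z of K[t]_d is encoded as a function on all subsets
   of [t] that vanishes off the d-subsets.  The value at y below is the
   coefficient of y in \sum_z f(z) gamma(z), where gamma(z) is the sum of the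
   subsets of z with one element less (so gamma(set0) = 0). *)
Definition gamma (f : {ffun {set 'I_t} -> K}) : {ffun {set 'I_t} -> K} :=
  [ffun y : {set 'I_t} =>
     \sum_(z : {set 'I_t} | (y \subset z) && (#|y|.+1 == #|z|)) f z].

Definition Harm (d : nat) (f : {ffun {set 'I_t} -> K}) : Prop :=
  (forall z : {set 'I_t}, #|z| != d -> f z = 0) /\ gamma f = [ffun=> 0].

End Harmonic.

Section Enumerator.
Variables (K : realType) (R : finUnitRingType) (n t : nat).
Variables (H : {group 'S_n}) (alpha : 'I_t -> 'I_n).
Variables (d : nat) (f : {ffun {set 'I_t} -> K}).

Definition ftilde (u : 'rV[R]_n) : K :=
  \sum_(v in Vtheta R H |
        (hwt H alpha v == d) && (hsupp H alpha v \subset hsupp H alpha u))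
     f (hsupp H alpha v).

Definition Xvar : {mpoly K[2]} := 'X_(@Ordinal 2 0 isT).
Definition Yvar : {mpoly K[2]} := 'X_(@Ordinal 2 1 isT).

Definition harmonic_enum (D : {set 'rV[R]_n}) : {mpoly K[2]} :=
  \sum_(u in D) ftilde u *:
     (Xvar ^+ (t - hwt H alpha u) * Yvar ^+ hwt H alpha u).

End Enumerator.

Arguments Xvar {K}.
Arguments Yvar {K}.

(* Agrees with p \is e.-homog for e >= 0, and holds only for p = 0 when
   e < 0; the degree t - 2d may be negative. *)
Definition homog_int (K : realType) (e : int) (p : {mpoly K[2]}) : Prop :=
  forall m, m \in msupp p -> (mdeg m)%:Z = e.

(* Main.v *)
(** Let q = |R|.

    Duality over R needs no characters.  For a maximal left ideal M of R, the
    right annihilator of M lies in the left socle, which is isomorphic to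
    R / Rad(R).  It therefore has at most as many elements as Hom(R / M, R / Rad(R)), and that group embeds
    into the dual of R / M over the finite division ring End(R / M); hence the
    annihilator has at most |R / M| elements.  So P |-> |P| |P^perp| is
    nondecreasing along the submodules of R^t; it equals q^t at both ends, so it
    is constant.  Applied to P + R^([t] \ S) this gives
      |P| |P^perp(S)| = q^|S| |P([t] \ S)|,
    where P(S) is the set of words of P supported in S.

    Harmonic functions.  A function f in Harm_d is a multilinear polynomial
    sum_z f(z) prod_(i in z) x_i which is invariant under x |-> x + c, because
    gamma f = 0 is the vanishing of the sum of its partial derivatives.
    Evaluating it at suitable two-valued points gives, for
    F(S) = sum_(z <= S) f(z), the rule F([t] \ S) = (-1)^d F(S) and a closed
    form for sum_(T >= S) F(T) Y^|T| (X - Y)^(t - |T|).  Hence F vanishes unless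
    d <= |S| <= t - d, and Z is a combination of the terms
    |P(T)| F(T) Y^(|T| - d) (X - Y)^(t - d - |T|), which the substitution
    (X + (q - 1) Y, X - Y) exchanges with those of the dual code. *)

Require Import Defs.
From HB Require Import structures.
From mathcomp Require Import all_boot all_order all_algebra all_fingroup.
From mathcomp Require Import reals.
From mathcomp Require Import mpoly.
From mathcomp Require Import zify ring.

Set Implicit Arguments.
Unset Strict Implicit.
Unset Printing Implicit Defensive.
Import GRing.Theory Num.Theory.
Local Open Scope ring_scope.

(** * Maximal left ideals of a finite ring *)

(** Each fibre of (a, m) |-> g a + m on A x M is a coset of the pairs (k, - g k) with k in A and g k
    in M. *)
Lemma card_sumset (T U : finZmodType) (g : T -> U) (A : {set T}) (M : {set U}) :
    (forall x y, g (x - y) = g x - g y) -> zmod_closed A -> zmod_closed M ->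
  (#|A| * #|M| =
     #|[set a in A | g a \in M]| * #|[set (g a + m)%R | a in A, m in M]|)%N.
Proof.
move=> gB zA zM.
have [A0 AB] := zA; have [M0 MB] := zM.
have g0 : g 0 = 0 by rewrite -[X in g X](subrr 0) gB subrr.
have gN x : g (- x) = - g x by rewrite -sub0r gB g0 sub0r.
have gD x y : g (x + y) = g x + g y by rewrite -{1}[y]opprK gB gN opprK.
have AD := Algebra.zmod_closedD zA; have MD := Algebra.zmod_closedD zM.
set K := [set a in A | _]; set N := [set (_ + _)%R | a in A, m in M].
rewrite -cardsX -sum1_card.
rewrite (partition_big (fun p => g p.1 + p.2) (mem N)) /=; last first.
  by case=> a m /setXP[/= Aa Mm]; apply/imset2P; exists a m.
rewrite mulnC -sum_nat_const; apply: eq_bigr => _ /imset2P[a0 m0 Aa0 Mm0 ->].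
rewrite sum1_card.
rewrite -(card_imset (mem K) (f := fun k => (a0 + k, m0 - g k))); last first.
  by move=> k l [/addrI].
apply: eq_card => -[a m]; apply/idP/imsetP; rewrite unfold_in /= ?in_setX.
  case/andP=> /andP[Aa Mm] /eqP E; exists (a - a0).
    rewrite !inE AB //= gB; have -> : g a - g a0 = m0 - m.
      by apply/eqP; rewrite subr_eq addrC addrA -E addrK.
    exact: MB.
  congr (_, _); first by rewrite addrC subrK.
  by rewrite gB opprB addrA [m0 + _]addrC -E addrAC subrr add0r.
case=> k; rewrite !inE => /andP[Ak Mk] [-> ->].
by rewrite (AD a0 k) // MB //= gD addrACA subrr addr0 eqxx.
Qed.

Lemma leq_card_sumset (T U : finZmodType) (g : T -> U) (A : {set T})
    (M N : {set U}) :
    (forall x y, g (x - y) = g x - g y) -> zmod_closed A -> zmod_closed M ->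
    (forall a m, a \in A -> m \in M -> g a + m \in N) ->
  (#|A| * #|M| <= #|[set a in A | g a \in M]| * #|N|)%N.
Proof.
move=> gB zA zM gAM; rewrite (@card_sumset _ _ g) // leq_mul2l.
apply/orP; right.
by apply/subset_leq_card/subsetP => _ /imset2P[a m Aa Mm ->]; apply: gAM.
Qed.

Lemma leq_mul_cross a b m n p q :
  (a * m <= b * n -> n * p <= m * q -> 0 < m * n -> a * p <= b * q)%N.
Proof.
by move=> le1 le2 gt0; rewrite -(leq_pmul2r gt0); move: (leq_mul le1 le2); lia.
Qed.

(** Here [p], [q] stand for the sizes of two nested codes, [dp], [dq] for those of their duals, [m],
    [r] for |M| and |R|, and [y] for the size of the right annihilator of M. *)
Lemma leq_mul_chain p dp q dq y m r : (dp <= dq * y -> y * m <= r ->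
  r * p <= m * q -> 0 < m * r -> p * dp <= q * dq)%N.
Proof.
move=> le1 le2 le3 gt0; rewrite -(leq_pmul2r gt0).
apply: (@leq_trans (p * (dq * y) * (m * r))).
  by rewrite leq_mul2r leq_mul2l le1 !orbT.
have -> : (p * (dq * y) * (m * r) = dq * ((y * m) * (r * p)))%N by lia.
have -> : (q * dq * (m * r) = dq * (r * (m * q)))%N by lia.
by rewrite leq_mul2l leq_mul ?orbT.
Qed.

Section MaximalLeftIdeals.
Variable R : finNzRingType.
Implicit Types (I J M P : {set R}).

Lemma left_idealP I :
  reflect (zmod_closed I /\ (forall r x, x \in I -> r * x \in I))
    (left_ideal I).
Proof.
apply: (iffP andP) => [[/andP[I0 /'forall_in_'forall_in_idP IB]] | [[I0 IB] IM]].
  move/'forall_'forall_in_idP => IM.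
  by split=> //; split=> // x y Ix Iy; apply: IB.
split; last by apply/'forall_'forall_in_idP.
rewrite /additive_subset I0; apply/'forall_in_'forall_in_idP => x Ix y Iy.
exact: IB.
Qed.

Definition maximal_left_ideal M : bool :=
  maxset (fun J => left_ideal J && (J != [set: R])) M.

(** The last condition says that M + R x contains 1, which is what maximality asks of the left ideal
    M + R x when x is outside M. *)
Lemma maximal_left_idealP M :
  reflect [/\ left_ideal M, 1 \notin M &
             forall x, x \notin M -> exists r, 1 - r * x \in M]
          (maximal_left_ideal M).
Proof.
have properE I : left_ideal I -> (I != [set: R]) = (1 \notin I).
  case/left_idealP=> _ IM; congr (~~ _).
  apply/eqP/idP => [->|I1]; first exact: in_setT.
  by apply/setP => x; rewrite in_setT -[x]mulr1 IM.
apply: (iffP maxsetP) => [[/andP[lM pM] maxM]|[lM M1 maxM]].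
  split=> //; first by rewrite -properE.
  have /left_idealP[[M0 MB] MM] := lM.
  move=> x Mx; pose J := [set y | [exists r, y - r * x \in M]].
  have MJ : M \subset J.
    apply/subsetP => y My; rewrite inE; apply/existsP; exists 0.
    by rewrite mul0r subr0.
  have Jx : x \in J.
    by rewrite inE; apply/existsP; exists 1; rewrite mul1r subrr.
  have lJ : left_ideal J.
    apply/left_idealP; split; first split; first by rewrite (subsetP MJ).
      move=> y z; rewrite !inE => /existsP[r yr] /existsP[s zs].
      apply/existsP; exists (r - s).
      by rewrite mulrBl opprD addrACA -opprD MB.
    move=> a y; rewrite !inE => /existsP[r yr]; apply/existsP; exists (a * r).
    by rewrite -mulrA -mulrBr MM.
  have: J = [set: R].
    apply/eqP; apply: contraT => pJ; case/negP: Mx.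
    by rewrite -(maxM J) // lJ.
  by move/setP/(_ 1); rewrite !inE => /existsP.
split; first by rewrite lM properE.
move=> J /andP[lJ]; rewrite properE // => J1 MJ.
have /left_idealP[zJ JM] := lJ; have JD := Algebra.zmod_closedD zJ.
apply/eqP; rewrite eqEsubset MJ andbT; apply/subsetP => x Jx.
apply: contraT => /maxM[r Mr]; case/negP: J1.
by rewrite -[1](subrK (r * x)) JD ?JM // (subsetP MJ).
Qed.

Lemma in_radical x :
  reflect (forall M, maximal_left_ideal M -> x \in M) (x \in radical R).
Proof. exact: bigcapP. Qed.

Lemma radical_zmod : zmod_closed (radical R).
Proof.
split; first by apply/in_radical => M /maximal_left_idealP[/left_idealP[[]]].
move=> x y /in_radical Rx /in_radical Ry; apply/in_radical => M mM.
have /maximal_left_idealP[/left_idealP[[_ MB] _] _ _] := mM.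
by rewrite MB ?Rx ?Ry.
Qed.

(** For y outside a maximal left ideal M, the left ideal of all r with r y in M is again maximal, so
    it contains the radical. *)
Lemma radical_mulr x y : x \in radical R -> x * y \in radical R.
Proof.
move=> /in_radical Rx; apply/in_radical => M mM.
have /maximal_left_idealP[/left_idealP[[M0 MB] MM] M1 maxM] := mM.
have [My|My] := boolP (y \in M); first exact: MM.
suff /Rx : maximal_left_ideal [set r | r * y \in M] by rewrite inE.
apply/maximal_left_idealP; split; last 2 first.
- by rewrite inE mul1r.
(* If 1 - r z y lies in M, then so does (1 - y r z) y = y (1 - r z y). *)
- move=> z; rewrite inE => /maxM[r Mr]; exists (y * r).
  by rewrite inE mulrBl mul1r -!mulrA -[X in X - _]mulr1 -mulrBr MM.
apply/left_idealP; split; first split; first by rewrite inE mul0r.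
  by move=> a b; rewrite !inE mulrBl; apply: MB.
by move=> a b; rewrite !inE -mulrA; apply: MM.
Qed.

(** If b is outside a maximal left ideal M, some 1 - r b lies in M, and b = b (1 - r b) + b r b puts
    b back in M. *)
Lemma radical_semiprime b :
  (forall r, b * r * b \in radical R) -> b \in radical R.
Proof.
move=> Rb; apply/in_radical => M mM.
have /maximal_left_idealP[/left_idealP[[M0 MB] MM] M1 maxM] := mM.
have zM : zmod_closed M by split.
apply: contraT => Mb; have [r Mr] := maxM _ Mb.
have Mbrb : b * r * b \in M by apply: (in_radical _ (Rb r)).
rewrite -(negPf Mb) -[b in b \in M](subrK (b * r * b)).
rewrite (Algebra.zmod_closedD zM) //.
by rewrite -mulrA -[X in X - _]mulr1 -mulrBr MM.
Qed.

(* [N / M] is the endomorphism ring of the simple left module [R / M], and it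
   is a finite division ring.  The product [X x R -> N] induces a pairing
   between [X / rad = Hom(R / M, R / rad)] and [R / M] over [N / M], and
   semiprimeness of the radical makes it nondegenerate on the left. *)
Lemma card_hom_simple_radical M : maximal_left_ideal M ->
  (#|[set b | [forall m in M, (m * b)%R \in radical R]]| * #|M|
     <= #|radical R| * #|R|)%N.
Proof.
move=> mM; have /maximal_left_idealP[/left_idealP[[M0 MB] MM] M1 maxM] := mM.
have zM : zmod_closed M by split.
have MD := Algebra.zmod_closedD zM; have [R0 RB] := radical_zmod.
set X := [set b | _].
have XM b m : b \in X -> m \in M -> m * b \in radical R.
  by rewrite inE => /forall_inP; apply.
have XB : zmod_closed X.
  split=> [|x y]; rewrite !inE; first by apply/forall_inP => m _; rewrite mulr0.
  move=> /forall_inP Xx /forall_inP Xy; apply/forall_inP => m Mm.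
  by rewrite mulrBr RB ?Xx ?Xy.
pose N := [set r | [forall m in M, m * r \in M]].
have NM m r : r \in N -> m \in M -> m * r \in M.
  by rewrite inE => /forall_inP; apply.
have NB : zmod_closed N.
  split=> [|x y]; rewrite !inE; first by apply/forall_inP => m _; rewrite mulr0.
  move=> /forall_inP Nx /forall_inP Ny; apply/forall_inP => m Mm.
  by rewrite mulrBr MB ?Nx ?Ny.
have NMul x y : x \in N -> y \in N -> x * y \in N.
  by move=> Nx Ny; rewrite inE; apply/forall_inP => m Mm; rewrite mulrA !NM.
have N1 : 1 \in N by rewrite inE; apply/forall_inP => m; rewrite mulr1.
pose perp P := [set b in X | [forall p in P, b * p \in M]].
have perpP b P :
    reflect (b \in X /\ forall p, p \in P -> b * p \in M) (b \in perp P).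
  rewrite /perp in_set.
  by apply: (iffP andP) => [[Xb /forall_inP]|[Xb /forall_inP]].
have perpM : X = perp M.
  by apply/setP => b; apply/idP/perpP => [Xb|[]//]; split=> // p; apply: MM.
rewrite {1}perpM.
(* [P] grows from M to R through right [N]-stable subgroups, one generator v at a time, and |perp P|
   |P| never decreases. At the start perp M = X; at the end perp R lies in the radical. *)
suff: forall k P, (#|R| - #|P| < k)%N -> zmod_closed P -> M \subset P ->
      (forall p e, p \in P -> e \in N -> p * e \in P) ->
      (#|perp P| * #|P| <= #|radical R| * #|R|)%N.
  by move=> /(_ _ M (ltnSn _)); apply=> // p e Mp Ne; apply: NM.
elim=> // k IHk P leP zP MP PN.
have [->|] := eqVneq P [set: R].
  rewrite cardsT leq_mul2r; apply/orP; right; apply/subset_leq_card.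
  (* Here b R lies in M and M b in the radical, so b r b is in the radical for every r. *)
  apply/subsetP => b /perpP[Xb Mb]; apply: radical_semiprime => r.
  by apply: (XM b) => //; apply: Mb; rewrite in_setT.
rewrite -subTset => /subsetPn[v _ Pv].
have [P0 PB] := zP.
have PD := Algebra.zmod_closedD zP.
pose Q := [set (v * e + p)%R | e in N, p in P].
have PQ : P \subset Q.
  apply/subsetP => p Pp; apply/imset2P; exists 0 p => //; first by case: NB.
  by rewrite mulr0 add0r.
have Qv : v \in Q by apply/imset2P; exists 1 0; rewrite ?mulr1 ?addr0.
have zQ : zmod_closed Q.
  split; first by rewrite (subsetP PQ).
  move=> _ _ /imset2P[e p Ne Pp ->] /imset2P[e' p' Ne' Pp' ->].
  apply/imset2P; exists (e - e') (p - p'); rewrite ?PB ?(proj2 NB) //.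
  by rewrite opprD addrACA mulrBr.
have QN q e : q \in Q -> e \in N -> q * e \in Q.
  move=> /imset2P[e' p Ne' Pp ->] Ne; apply/imset2P; exists (e' * e) (p * e).
  - exact: NMul.
  - exact: PN.
  - by rewrite mulrDl mulrA.
have ltPQ : (#|P| < #|Q|)%N.
  by apply/proper_card/properP; split=> //; exists v.
have {IHk} IHQ : (#|perp Q| * #|Q| <= #|radical R| * #|R|)%N.
  apply: IHk => //; last exact: subset_trans MP PQ.
  rewrite -ltnS (leq_trans _ leP) // ltnS ltn_sub2l //.
  by rewrite (leq_trans ltPQ) // max_card.
apply: leq_trans IHQ.
have zperp : zmod_closed (perp P).
  split; first by apply/perpP; split; [case: XB | move=> p _; rewrite mul0r].
  move=> x y /perpP[Xx Px] /perpP[Xy Py]; apply/perpP.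
  by split=> [|p Pp]; [rewrite (proj2 XB) | rewrite mulrBl MB ?Px ?Py].
(* The map b |-> b v sends perp P into N, since M b v lies in the radical and hence in M; the
   elements sent into M lie in perp Q. *)
have le1 : (#|perp P| * #|M| <= #|perp Q| * #|N|)%N.
  apply: leq_trans (@leq_card_sumset _ _ (fun b => b * v) _ _ N _ _ _ _) _ => //.
  - by move=> x y; rewrite mulrBl.
  - move=> b m /perpP[Xb _] Mm; rewrite inE; apply/forall_inP => m' Mm'.
    rewrite mulrDr mulrA MD //; last exact: MM.
    by apply: (in_radical _ _ M) => //; apply/radical_mulr/XM.
  rewrite leq_mul2r; apply/orP; right; apply/subset_leq_card/subsetP => b.
  rewrite in_set => /andP[/perpP[Xb Pb] Mbv]; apply/perpP.
  split=> // _ /imset2P[e p Ne Pp ->].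
  by rewrite mulrDr mulrA MD //; [apply: NM | apply: Pb].
(* If e is outside M, right multiplication by e is injective on R / M, so by pigeonhole some
   positive power of e is 1 modulo M. Then v is congruent modulo M to v times that power, which lies
   in P, contrary to the choice of v. *)
have vN_P e : e \in N -> v * e \in P -> e \in M.
  move=> Ne Pve; apply: contraT => Me.
  have cancelM r : r * e \in M -> r \in M.
    move=> Mre; apply: contraT => /maxM[s Ms]; case/negP: Me.
    have Mse := NM _ _ Ne Ms; rewrite mulrBl mul1r -mulrA in Mse.
    by rewrite -[e](subrK (s * (r * e))) MD // MM.
  have cancelX i r : r * e ^+ i \in M -> r \in M.
    elim: i => [|i IHi]; rewrite ?mulr1 // exprSr mulrA => /cancelM; exact: IHi.
  have [i Mi] : exists i, 1 - e ^+ i.+1 \in M.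
    have /injectivePn[i [j neq_ij eq_ij]] :
        ~~ injectiveb (fun i : 'I_(#|R|.+1) => e ^+ i).
      by apply/negP => /injectiveP/leq_card; rewrite card_ord ltnn.
    wlog lt_ij : i j neq_ij eq_ij / (i < j)%N => [IH|].
      case: (ltngtP i j) => [|lt_ji|/ord_inj] ; first exact: IH.
        by apply: (IH j i) => //; rewrite eq_sym.
      by move/eqP; rewrite (negPf neq_ij).
    exists (j - i).-1; rewrite prednK ?subn_gt0 //; apply: (cancelX i).
    by rewrite mulrBl mul1r -exprD subnK ?(ltnW lt_ij) // eq_ij subrr.
  case/negP: Pv; rewrite -[v](subrK (v * e ^+ i.+1)) PD //.
    by rewrite -[X in X - _]mulr1 -mulrBr (subsetP MP) ?MM.
  elim: i {Mi} => [|i IHi]; first by rewrite expr1.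
  by rewrite exprSr mulrA PN.
have le2 : (#|N| * #|P| <= #|M| * #|Q|)%N.
  apply: leq_trans (@leq_card_sumset _ _ (fun e => v * e) _ _ Q _ _ _ _) _ => //.
  - by move=> x y; rewrite mulrBr.
  - by move=> e p Ne Pp; apply/imset2P; exists e p.
  rewrite leq_mul2r; apply/orP; right; apply/subset_leq_card/subsetP => e.
  by rewrite in_set => /andP[Ne Pe]; apply: vN_P.
have gtMN : (0 < #|M| * #|N|)%N.
  rewrite muln_gt0 !card_gt0; apply/andP.
  by split; apply/set0Pn; [exists 0 | exists 1].
exact: leq_mul_cross le1 le2 gtMN.
Qed.

End MaximalLeftIdeals.

(** * Duality over a Frobenius ring *)

Section FrobeniusRing.
Variable R : finNzRingType.

Lemma rad_coset_eq (x y : R) :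
  (rad_coset x == rad_coset y) = (x - y \in radical R).
Proof.
have zR := radical_zmod R; have RD := Algebra.zmod_closedD zR.
have [R0 RB] := zR; have RN := GRing.zmod_closedN zR.
apply/eqP/idP => [/setP/(_ x)|Rxy].
  have -> : x \in rad_coset x by apply/imsetP; exists 0; rewrite ?addr0.
  by case/esym/imsetP=> a Ra ->; rewrite addrC addKr.
apply/setP => z; apply/imsetP/imsetP => -[a Ra ->].
  exists (x - y + a); first exact: RD.
  by rewrite addrA [y + _]addrC subrK.
exists (y - x + a); first by apply: RD; rewrite // -opprB RN.
by rewrite addrA [x + _]addrC subrK.
Qed.

(** For nonzero a, the map r |-> r a identifies R / M with R a, which is therefore a minimal left
    ideal. *)
Lemma annihilated_in_socle (M : {set R}) (a : R) : maximal_left_ideal M ->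
  (forall m, m \in M -> m * a = 0) -> a \in socle (@left_ideal R).
Proof.
case/maximal_left_idealP=> /left_idealP[[M0 MB] MM] M1 maxM Ma.
apply/bigcapP => J /andP[/left_idealP[[J0 JB] JM] /forallP minJ].
have [->//|a0] := eqVneq a 0.
pose L := [set (r * a)%R | r : R].
have La : a \in L by apply/imsetP; exists 1; rewrite ?mul1r.
suff minL : minset (fun I => left_ideal I && (I != [set 0])) L.
  by have /implyP/(_ minL)/subsetP := minJ L; apply.
have lL : left_ideal L.
  apply/left_idealP; split; first split.
  - by apply/imsetP; exists 0; rewrite ?mul0r.
  - move=> _ _ /imsetP[r _ ->] /imsetP[s _ ->]; apply/imsetP.
    by exists (r - s); rewrite ?mulrBl.
  - by move=> r _ /imsetP[s _ ->]; apply/imsetP; exists (r * s); rewrite ?mulrA.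
apply/minsetP; split.
  by rewrite lL; apply: contra a0 => /eqP L0; rewrite -in_set1 -L0.
move=> B /andP[/left_idealP[[B0 BB] BM] Bn0] BL.
apply/eqP; rewrite eqEsubset BL /=.
have /subsetPn[b Bb b0] : ~~ (B \subset [set 0]).
  by apply: contra Bn0 => sB0; rewrite eqEsubset sB0 sub1set B0.
have /imsetP[r _ def_b] := subsetP BL b Bb.
have /maxM[s Ms] : r \notin M.
  by apply: contra b0 => Mr; rewrite def_b Ma ?in_set1.
have Ba : a \in B.
  move/Ma/eqP: Ms; rewrite mulrBl mul1r subr_eq0 -mulrA -def_b => /eqP->.
  exact: BM.
by apply/subsetP => _ /imsetP[c _ ->]; apply: BM.
Qed.

(** The isomorphism [phi] from R / Rad(R) to the left socle pulls the annihilator Y back to classes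
    of elements b with M b in the radical, and these have been counted. *)
Lemma card_right_annihilator (M : {set R}) :
    frobenius_left R -> maximal_left_ideal M ->
  (#|[set a | [forall m in M, (m * a == 0)%R]]| * #|M| <= #|R|)%N.
Proof.
move=> [phi [phi_inj phi_soc phiD phiM]] mM.
have zR := radical_zmod R; have [R0 RB] := zR.
set Y := [set a | _]; pose g x := phi (rad_coset x).
have gD x y : g (x + y) = g x + g y by exact: phiD.
have g0 : g 0 = 0 by apply/(addrI (g 0)); rewrite -gD !addr0.
have gB x y : g (x - y) = g x - g y.
  by apply/(addIr (g y)); rewrite -gD !subrK.
have g_eq0 x : (g x == 0) = (x \in radical R).
  by rewrite -g0 /g (inj_in_eq phi_inj) ?imset_f // rad_coset_eq subr0.
pose X := [set b | [forall m in M, (m * b)%R \in radical R]].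
have zX : zmod_closed X.
  split=> [|x y]; rewrite !inE; first by apply/forall_inP => m _; rewrite mulr0.
  move=> /forall_inP Xx /forall_inP Xy; apply/forall_inP => m Mm.
  by rewrite mulrBr RB ?Xx ?Xy.
have z0 : zmod_closed [set 0 : R].
  by split=> [|x y]; rewrite !inE // => /eqP-> /eqP->; rewrite subr0.
have le_YX : (#|radical R| * #|Y| <= #|X|)%N.
  have := card_sumset gB zX z0; rewrite cards1 muln1 => ->.
  apply: leq_mul; apply/subset_leq_card/subsetP.
    move=> x Rx; rewrite inE in_set1 g_eq0 Rx andbT inE.
    apply/forall_inP => m _.
    apply/in_radical => N mN.
    have /maximal_left_idealP[/left_idealP[_ NM] _ _] := mN.
    by rewrite NM // (in_radical _ Rx).
  move=> a; rewrite inE => /forall_inP Ma.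
  have Ma0 m : m \in M -> m * a = 0 by move/Ma/eqP.
  have := annihilated_in_socle mM Ma0; rewrite -phi_soc.
  case/imsetP=> _ /imsetP[b _ ->] def_a; apply/imset2P.
  exists b 0; rewrite ?in_set1 ?addr0 //.
  rewrite inE; apply/forall_inP => m Mm.
  by rewrite -g_eq0 /g phiM -def_a Ma.
have R_gt0 : (0 < #|radical R|)%N by rewrite card_gt0; apply/set0Pn; exists 0.
rewrite -(leq_pmul2l R_gt0) mulnA.
apply: leq_trans (card_hom_simple_radical mM).
by rewrite leq_mul2r le_YX orbT.
Qed.

End FrobeniusRing.

Section Duality.
Variables (R : finUnitRingType) (t : nat).
Implicit Types (P Q : {set 'rV[R]_t}) (u v w : 'rV[R]_t).

Lemma form_linearl a u v w :
  Defs.form (a *: u + v) w = a * Defs.form u w + Defs.form v w.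
Proof.
rewrite /Defs.form mulr_sumr -big_split /=; apply: eq_bigr => i _.
by rewrite !mxE mulrDl mulrA.
Qed.

Lemma formBr u v w : Defs.form u (v - w) = Defs.form u v - Defs.form u w.
Proof.
rewrite /Defs.form -sumrB; apply: eq_bigr => i _.
by rewrite !mxE mulrBr.
Qed.

Lemma form0l w : Defs.form 0 w = 0.
Proof. by rewrite /Defs.form big1 // => i _; rewrite mxE mul0r. Qed.

Lemma form0r u : Defs.form u 0 = 0.
Proof. by rewrite /Defs.form big1 // => i _; rewrite mxE mulr0. Qed.

Lemma form_deltal i w : Defs.form (delta_mx 0 i) w = w 0 i.
Proof.
rewrite /Defs.form (bigD1 i) //= big1 ?addr0 ?mxE ?eqxx ?mul1r // => j neq_ji.
by rewrite mxE (negPf neq_ji) andbF mul0r.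
Qed.

Lemma in_right_dual P u :
  reflect (forall v, v \in P -> Defs.form v u = 0) (u \in right_dual P).
Proof. by rewrite inE; apply: (iffP 'forall_in_eqP). Qed.

Lemma right_dual_zmod P : zmod_closed (right_dual P).
Proof.
split; first by apply/in_right_dual => v _; apply: form0r.
move=> x y /in_right_dual Px /in_right_dual Py; apply/in_right_dual => v Pv.
by rewrite formBr Px // Py // subr0.
Qed.

Let submodb P :=
  (0 \in P) &&
  [forall a : R, forall u in P, forall v in P, (a *: u + v)%R \in P].

Lemma submodP P : reflect (submod_closed P) (submodb P).
Proof.
apply: (iffP andP) => -[P0].
  move/'forall_'forall_in_'forall_in_idP => PZ.
  by split=> // a u v Pu Pv; apply: PZ.
move=> PZ; split=> //; apply/'forall_'forall_in_'forall_in_idP => a u Pu v.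
exact: PZ.
Qed.

Hypothesis frobR : frobenius_left R.

(* If [Q] covers [P] then [Q / P = R / M] for a maximal left ideal [M], and
   [right_dual P / right_dual Q] embeds into the right annihilator of [M]. *)
Lemma leq_card_dual P Q : submod_closed P -> submod_closed Q -> P \subset Q ->
  (#|P| * #|right_dual P| <= #|Q| * #|right_dual Q|)%N.
Proof.
have [k] := ubnP (#|Q| - #|P|); elim: k P Q => // k IHk P Q ltk smP smQ sPQ.
have [->//|neqPQ] := eqVneq P Q.
have ltPQ : P \proper Q by rewrite properEneq neqPQ.
(* [Q'] covers [P]: it is minimal among the submodules strictly above [P]. The induction handles the
   rest of the way from [Q'] to [Q]. *)
have [|Q' /minsetP[/andP[/submodP smQ' ltPQ'] minQ'] sQ'Q] :=
    @minset_exists _ (fun Q' => submodb Q' && (P \proper Q')) Q.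
  by rewrite ltPQ andbT; apply/submodP.
have ltc := proper_card ltPQ'.
apply: leq_trans (IHk Q' Q _ smQ' smQ sQ'Q); last first.
  by move: ltk (subset_leq_card sQ'Q); lia.
have /properP[sPQ' [x Q'x Px]] := ltPQ'.
have [P0 PZ] := smP; have [Q0 QZ] := smQ'.
have zP := GRing.submod_closedB smP; have zQ := GRing.submod_closedB smQ'.
have PD := Algebra.zmod_closedD zP; have QD := Algebra.zmod_closedD zQ.
have PB := proj2 zP.
have scaleP a u : u \in P -> a *: u \in P.
  by move=> Pu; rewrite -[_ *: _]addr0 PZ.
have scaleQ a u : u \in Q' -> a *: u \in Q'.
  by move=> Qu; rewrite -[_ *: _]addr0 QZ.
pose M := [set r | (r *: x)%R \in P].
have lM : left_ideal M.
  apply/left_idealP; split; first split; first by rewrite inE scale0r.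
    by move=> r s; rewrite !inE scalerBl; apply: PB.
  by move=> r s; rewrite !inE -scalerA; apply: scaleP.
have mM : maximal_left_ideal M.
  apply/maximal_left_idealP; split=> //; first by rewrite inE scale1r.
  move=> y; rewrite inE => Py.
  (* [B] is P + R y x; minimality of [Q'] forces it to contain x, which gives an inverse of y modulo
     [M]. *)
  pose B := [set u | [exists r : R, (u - (r * y) *: x)%R \in P]].
  have sPB : P \subset B.
    apply/subsetP => u Pu; rewrite inE; apply/existsP; exists 0.
    by rewrite mul0r scale0r subr0.
  have sBQ : B \subset Q'.
    apply/subsetP => u; rewrite inE => /existsP[r Pur].
    by rewrite -[u](subrK ((r * y) *: x)) QD ?scaleQ // (subsetP sPQ').
  have : B = Q'.
    apply: minQ' => //; apply/andP; split.
      apply/submodP; split; first exact: (subsetP sPB).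
      move=> a u v; rewrite !inE => /existsP[r Pr] /existsP[s Ps].
      apply/existsP; exists (a * r + s).
      rewrite mulrDl scalerDl opprD addrACA -mulrA.
      rewrite -[(a * _) *: _]scalerA -scalerBr.
      exact: PZ.
    apply/properP; split=> //; exists (y *: x); last by [].
    by rewrite inE; apply/existsP; exists 1; rewrite mul1r subrr.
  move/setP/(_ x); rewrite Q'x inE => /existsP[r Pr].
  by exists r; rewrite inE scalerBl scale1r.
have gt0M : (0 < #|M|)%N.
  by rewrite card_gt0; apply/set0Pn; exists 0; rewrite inE scale0r.
have gt0R : (0 < #|R|)%N by apply/card_gt0P; exists 0.
(* The map u |-> (x, u) sends the dual of P into the right annihilator of M. If (x, u) = 0, then u
   is orthogonal to P and to x, hence to all of [Q'] by minimality. *)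
have le1 : (#|right_dual P| <= #|right_dual Q'| *
              #|[set a | [forall m in M, (m * a == 0)%R]]|)%N.
  have z0 : zmod_closed [set 0 : R].
    by split=> [|a b]; rewrite !inE // => /eqP-> /eqP->; rewrite subr0.
  set Y := [set a | _].
  have formY u b :
      u \in right_dual P -> b \in [set 0 : R] -> Defs.form x u + b \in Y.
    move=> /in_right_dual Pu; rewrite in_set1 => /eqP->; rewrite addr0 inE.
    apply/forall_inP => m; rewrite inE => Pm; rewrite -(Pu _ Pm).
    by rewrite -[m *: x]addr0 form_linearl form0l addr0.
  have := leq_card_sumset (formBr x) (right_dual_zmod P) z0 formY.
  rewrite cards1 muln1 => /leq_trans; apply.
  rewrite leq_mul2r; apply/orP; right; apply/subset_leq_card/subsetP => u.
  rewrite inE in_set1 => /andP[/in_right_dual Pu /eqP xu]; apply/in_right_dual.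
  pose B := [set v in Q' | Defs.form v u == 0].
  have BQ : B = Q'.
    apply: minQ'; last by apply/subsetP => v; rewrite inE => /andP[].
    apply/andP; split.
      apply/submodP; split; first by rewrite inE Q0 form0l eqxx.
      move=> a v w; rewrite !inE => /andP[Qv /eqP v0] /andP[Qw /eqP w0].
      by rewrite QZ //= form_linearl v0 w0 mulr0 addr0.
    apply/properP; split; last by exists x; rewrite // inE Q'x xu /=.
    by apply/subsetP => v Pv; rewrite inE (subsetP sPQ') // Pu /=.
  by move=> v; rewrite -BQ inE => /andP[_ /eqP].
have le2 := card_right_annihilator frobR mM.
have le3 : (#|R| * #|P| <= #|M| * #|Q'|)%N.
  have zT : zmod_closed [set: R] by split=> [|a b _ _]; rewrite inE.
  rewrite -cardsT.
  apply: leq_trans (@leq_card_sumset _ _ ( *:%R^~ x) _ _ Q' _ zT zP _) _.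
  - by move=> r s; rewrite scalerBl.
  - by move=> r p _ Pp; rewrite QD ?scaleQ // (subsetP sPQ').
  rewrite leq_mul2r; apply/orP; right; apply/subset_leq_card/subsetP => r.
  by rewrite !inE.
by apply: leq_mul_chain le1 le2 le3 _; rewrite muln_gt0 gt0M.
Qed.

Lemma card_right_dual P :
  submod_closed P -> (#|P| * #|right_dual P| = #|R| ^ t)%N.
Proof.
move=> smP; have [P0 _] := smP.
have cV : #|[set: 'rV[R]_t]| = (#|R| ^ t)%N by rewrite cardsT card_mx mul1n.
have sm0 : submod_closed [set 0 : 'rV[R]_t].
  by split=> [|a u v]; rewrite !inE // => /eqP-> /eqP->; rewrite scaler0 addr0.
have smT : submod_closed [set: 'rV[R]_t] by split=> [|a u v _ _]; rewrite inE.
apply/eqP; rewrite eqn_leq; apply/andP; split.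
  apply: leq_trans (leq_card_dual smP smT (subsetT P)) _.
  rewrite cV (_ : right_dual _ = [set 0]) ?cards1 ?muln1 //.
  apply/setP => u; rewrite in_set1; apply/in_right_dual/eqP => [u0|-> v _].
    by apply/rowP => i; rewrite -form_deltal u0 ?in_setT // mxE.
  exact: form0r.
apply: leq_trans (leq_card_dual sm0 smP _); last by rewrite sub1set.
rewrite cards1 mul1n (_ : right_dual _ = [set: _]) ?cV //.
apply/setP => u; rewrite in_setT; apply/in_right_dual => v.
by rewrite in_set1 => /eqP->; rewrite form0l.
Qed.

End Duality.

(** * Words with prescribed support, and shortened dual codes *)

Section RowSupport.
Variables (R : finUnitRingType) (t : nat).
Implicit Types (P : {set 'rV[R]_t}) (S : {set 'I_t}) (u v : 'rV[R]_t).

Definition row_supp u : {set 'I_t} := [set i | u 0 i != 0].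

Lemma row_suppP u S :
  reflect (forall i, i \notin S -> u 0 i = 0) (row_supp u \subset S).
Proof.
apply: (iffP subsetP) => [uS i S'i|u0 i].
  by apply/eqP; apply: contraNT S'i => ui; rewrite uS // inE.
by rewrite inE; apply: contra_neqT => /u0.
Qed.

Lemma card_pfamily_row (Q : {pred R}) S :
  #|[set u : 'rV[R]_t |
       (row_supp u \subset S) && [forall i in S, u 0 i \in Q]]| =
    (#|Q| ^ #|S|)%N.
Proof.
rewrite -(card_pffun_on 0 (mem S) Q).
pose F (g : {ffun 'I_t -> R}) : 'rV[R]_t := \row_i g i.
have F_inj : injective F.
  by move=> g h /rowP E; apply/ffunP => i; have := E i; rewrite !mxE.
rewrite -(card_imset _ F_inj); apply: eq_card => u; rewrite inE.
apply/andP/imsetP => [[/row_suppP uS /forall_inP uQ]|].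
  exists [ffun i => u 0 i]; last by apply/rowP => i; rewrite mxE ffunE.
  apply/pfamilyP; split; first by apply/supportP => i /uS; rewrite ffunE.
  by move=> i /uQ; rewrite ffunE.
case=> g /pfamilyP[/supportP gS gQ] ->.
split; first by apply/row_suppP => i /gS; rewrite mxE.
by apply/forall_inP => i /gQ; rewrite mxE.
Qed.

Lemma card_row_supp_sub S :
  #|[set u : 'rV[R]_t | row_supp u \subset S]| = (#|R| ^ #|S|)%N.
Proof.
rewrite -(card_pfamily_row predT); apply: eq_card => u; rewrite !inE.
by rewrite (_ : [forall i in S, _]) ?andbT //; apply/forall_inP.
Qed.

Lemma card_row_supp S :
  #|[set u : 'rV[R]_t | row_supp u == S]| = (#|R|.-1 ^ #|S|)%N.
Proof.
rewrite -(cardC1 (0 : R)) -(card_pfamily_row (predC1 0)); apply: eq_card => u.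
rewrite !inE eqEsubset; congr (_ && _).
by apply/subsetP/forall_inP => E i /E; rewrite !inE.
Qed.

Lemma card_shortened_dual P S : frobenius_left R -> submod_closed P ->
  (#|P| * #|[set u in right_dual P | row_supp u \subset S]| =
     #|R| ^ #|S| * #|[set v in P | row_supp v \subset ~: S]|)%N.
Proof.
move=> frobR smP; have [P0 PZ] := smP.
pose U := [set u : 'rV[R]_t | row_supp u \subset ~: S].
have UP u : reflect (forall i, i \in S -> u 0 i = 0) (u \in U).
  rewrite inE; apply: (iffP (row_suppP _ _)) => u0 i.
    by move=> Si; apply: u0; rewrite inE Si.
  by rewrite inE negbK; apply: u0.
have smU : submod_closed U.
  split=> [|a u v /UP u0 /UP v0]; apply/UP => i Si; first by rewrite mxE.
  by rewrite !mxE u0 // v0 // mulr0 addr0.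
pose Q := [set (a + m)%R | a in P, m in U].
have smQ : submod_closed Q.
  split; first by apply/imset2P; exists 0 0; rewrite ?addr0 //; case: smU.
  move=> a _ _ /imset2P[u m Pu Um ->] /imset2P[v l Pv Ul ->].
  apply/imset2P; exists (a *: u + v) (a *: m + l); rewrite ?PZ ?(proj2 smU) //.
  by rewrite scalerDr addrACA.
(* [U] contains the unit vectors outside S, so being orthogonal to [U] means being supported in
   S. *)
have dualQ : right_dual Q = [set u in right_dual P | row_supp u \subset S].
  apply/setP => u; rewrite in_set.
  apply/in_right_dual/andP => [uQ|[/in_right_dual uP /row_suppP uS]]; last first.
    move=> _ /imset2P[v m Pv /UP Um ->]; rewrite -[v]scale1r form_linearl uP //.
    rewrite mulr0 add0r /Defs.form big1 // => i _.
    by have [/Um->|/uS->] := boolP (i \in S); rewrite ?mul0r ?mulr0.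
  split; first apply/in_right_dual => v Pv.
    by apply/uQ/imset2P; exists v 0; rewrite ?addr0 //; case: smU.
  apply/row_suppP => i S'i; rewrite -form_deltal; apply/uQ/imset2P.
  exists 0 (delta_mx 0 i); rewrite ?add0r //; apply/UP => j Sj.
  rewrite mxE; case: eqP => //= _; case: eqP => // eq_ji.
  by rewrite -eq_ji Sj in S'i.
have cQ := card_right_dual frobR smQ.
have cPU : (#|P| * #|U| = #|[set v in P | row_supp v \subset ~: S]| * #|Q|)%N.
  rewrite (@card_sumset _ _ id P U (fun _ _ => erefl)
    (GRing.submod_closedB smP) (GRing.submod_closedB smU)).
  by congr (_ * _)%N; apply: eq_card => v; rewrite !inE.
rewrite card_row_supp_sub in cPU.
have R_gt0 : (0 < #|R|)%N by apply/card_gt0P; exists 0.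
have gtU : (0 < #|R| ^ #|~: S|)%N by rewrite expn_gt0 R_gt0.
apply/eqP; rewrite -(eqn_pmul2r gtU) -dualQ; apply/eqP.
rewrite mulnAC cPU -mulnA cQ [RHS]mulnAC -expnD mulnC.
by rewrite cardsC card_ord.
Qed.

End RowSupport.

(** * Harmonic functions *)

Section HarmonicFunctions.
Variables (K : realType) (t d : nat) (f : {ffun {set 'I_t} -> K}).
Hypothesis f_harm : Harm d f.
Implicit Types (S T y z : {set 'I_t}).

(** On the support of a word this is [ftilde] up to the factor (q - 1)^d. *)
Definition subset_sum S : K := \sum_(z : {set 'I_t} | z \subset S) f z.

Lemma subset_sum_small S : (#|S| < d)%N -> subset_sum S = 0.
Proof.
case: f_harm => f0 _ ltSd; apply: big1 => z /subset_leq_card zS.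
by apply: f0; rewrite neq_ltn (leq_ltn_trans zS).
Qed.

(** Descending induction on |y| from the case |y| = d - 1, which is gamma f = 0. Summing the case of
    i |: y over all i outside y counts each d-set z above y exactly d - |y| times, and this number
    is nonzero in K. *)
Lemma superset_sum y :
  \sum_(z : {set 'I_t} | y \subset z) f z = if (#|y| < d)%N then 0 else f y.
Proof.
have [f0 gf0] := f_harm.
case: ltnP => [lty|ley]; last first.
  rewrite (bigD1 y) //= big1 ?addr0 // => z /andP[yz neq_zy].
  apply: f0; rewrite neq_ltn (leq_ltn_trans ley) ?orbT //.
  by rewrite proper_card // properEneq eq_sym neq_zy.
have [k] := ubnP (d - #|y|); elim: k y lty => // k IHk y lty ltk.
have [eq_d|neq_d] := eqVneq #|y|.+1 d.
  have /ffunP/(_ y) := gf0; rewrite !ffunE => {2}<-.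
  rewrite [RHS]big_mkcondr /=; apply: eq_bigr => z _.
  by case: eqP => // /eqP neq; rewrite f0 // -eq_d eq_sym.
have : \sum_(i | i \notin y) \sum_(z : {set 'I_t} | i |: y \subset z) f z = 0.
  apply: big1 => i y'i.
  have card_iy : #|i |: y| = #|y|.+1 by rewrite cardsU1 y'i.
  by apply: IHk; rewrite card_iy; lia.
rewrite (exchange_big_dep (fun z => y \subset z)) /=; last first.
  by move=> i z _; rewrite subUset => /andP[].
rewrite (eq_bigr (fun z => (d - #|y|)%:R * f z)) => [|z yz].
  rewrite -mulr_sumr => /eqP; rewrite mulf_eq0 pnatr_eq0 => /orP[/eqP|/eqP //].
  by lia.
rewrite (eq_bigl (fun i => i \in z :\: y)) => [|i]; last first.
  by rewrite inE subUset sub1set yz andbT.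
rewrite sumr_const mulr_natl.
have [<-|/f0->] := eqVneq #|z| d; last by rewrite !mul0rn.
by rewrite cardsD (setIidPr yz).
Qed.

Section Evaluation.
Variable A : comAlgType K.
Implicit Types (x : 'I_t -> A) (c p r : A).

(** The multilinear polynomial of [f], at points of a commutative K-algebra: both scalars and
    polynomials in X, Y are substituted. *)
Definition set_mpeval x : A := \sum_(z : {set 'I_t}) f z *: \prod_(i in z) x i.

Lemma prod_addr z x c :
  \prod_(i in z) (x i + c) =
    \sum_(y : {set 'I_t} | y \subset z)
      (\prod_(i in y) x i) * c ^+ (#|z| - #|y|).
Proof.
rewrite big_mkcond /=.
pose F i := if i \in z then x i else 0; pose G i := if i \in z then c else 1.
rewrite (eq_bigr (fun i => F i + G i)) => [|i _]; last first.
  by rewrite /F /G; case: ifP; rewrite ?add0r.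
rewrite bigA_distr [RHS]big_mkcond; apply: eq_bigr => y _.
case: ifPn => [yz|/subsetPn[i yi z'i]]; last first.
  by rewrite (bigD1 i) //= yi /F (negPf z'i) mul0r.
rewrite (bigID (mem y)) /=; congr (_ * _).
  by apply: eq_bigr => i yi; rewrite yi /F (subsetP yz).
rewrite -[in RHS](setIidPr yz) -cardsD -prodr_const big_mkcond [RHS]big_mkcond.
apply: eq_bigr => i _; rewrite inE /G; case: ifP => // y'i.
by rewrite (negPf y'i).
Qed.

(* [gamma f = 0] says that the sum of the partial derivatives of the
   multilinear polynomial with coefficients [f] vanishes. *)
Lemma set_mpeval_translate x c :
  set_mpeval (fun i => x i + c) = set_mpeval x.
Proof.
have [f0 _] := f_harm; rewrite /set_mpeval.
transitivity (\sum_(z : {set 'I_t}) \sum_(y : {set 'I_t} | y \subset z)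
                 f z *: ((\prod_(i in y) x i) * c ^+ (d - #|y|))).
  apply: eq_bigr => z _; rewrite prod_addr scaler_sumr; apply: eq_bigr => y _.
  by have [->//|/f0->] := eqVneq #|z| d; rewrite !scale0r.
rewrite (exchange_big_dep predT) //=; apply: eq_bigr => y _.
(* Coefficients with |y| < d cancel; otherwise the truncated exponent d - |y| is 0. *)
rewrite -scaler_suml superset_sum; case: ltnP => [lty|ley].
  by rewrite f0 ?scale0r // neq_ltn lty.
by rewrite (eqP ley) expr0 mulr1.
Qed.

Lemma set_mpeval_indicator S c :
  set_mpeval (fun i => if i \in S then c else 0) = subset_sum S *: c ^+ d.
Proof.
have [f0 _] := f_harm.
rewrite /set_mpeval /subset_sum scaler_suml [RHS]big_mkcond.
apply: eq_bigr => z _; case: ifPn => [zS|/subsetPn[i zi S'i]]; last first.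
  by rewrite (bigD1 i) //= (negPf S'i) mul0r scaler0.
rewrite (eq_bigr (fun _ => c)) => [|i zi]; last by rewrite (subsetP zS).
by rewrite prodr_const; have [->//|/f0->] := eqVneq #|z| d; rewrite !scale0r.
Qed.

Lemma sum_superset_exp S p r :
  \sum_(T : {set 'I_t} | S \subset T) p ^+ #|T| * r ^+ (t - #|T|) =
    p ^+ #|S| * (p + r) ^+ (t - #|S|).
Proof.
have cC T : (t - #|T|)%N = #|~: T| by rewrite [RHS]cardsCs setCK card_ord.
pose G i := if i \in S then 0 else r.
transitivity (\prod_i (p + G i)); last first.
  rewrite (bigID (mem S)) /= cC -!prodr_const; congr (_ * _).
    by apply: eq_bigr => i Si; rewrite /G Si addr0.
  by apply: eq_big => [i|i S'i]; rewrite ?inE // /G (negPf S'i).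
rewrite bigA_distr big_mkcond /=; apply: eq_bigr => T _.
case: ifPn => [ST|/subsetPn[i Si T'i]]; last first.
  by rewrite (bigD1 i) //= (negPf T'i) /G Si mul0r.
rewrite (bigID (mem T)) /= cC -!prodr_const; congr (_ * _).
  by apply: eq_bigr => i ->.
apply: eq_big => [i|i]; first by rewrite inE.
rewrite inE => T'i; rewrite (negPf T'i) /G; case: ifP => // /(subsetP ST).
by rewrite (negPf T'i).
Qed.

(** The point with value r on S and 0 elsewhere is translated by p. Its value before the shift gives
    the right side. After the shift, the term of z matches the sum over all T containing both S and
    z; the factor (p + r)^d balances the exponents. *)
Lemma sum_superset_subset_sum S p r :
  (p + r) ^+ d *
      (\sum_(T : {set 'I_t} | S \subset T)
         subset_sum T *: (p ^+ #|T| * r ^+ (t - #|T|))) =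
    subset_sum S *: (p ^+ #|S| * (p + r) ^+ (t - #|S|) * r ^+ d).
Proof.
have [f0 _] := f_harm.
rewrite [RHS]scalerAr -set_mpeval_indicator -(set_mpeval_translate _ p).
transitivity ((p + r) ^+ d *
  \sum_(z : {set 'I_t})
    f z *: (p ^+ #|S :|: z| * (p + r) ^+ (t - #|S :|: z|))).
  congr (_ * _); under eq_bigr do rewrite scaler_suml.
  rewrite (exchange_big_dep predT) //=; apply: eq_bigr => z _.
  rewrite -scaler_sumr; congr (_ *: _); rewrite -sum_superset_exp.
  by apply: eq_bigl => T; rewrite subUset.
rewrite /set_mpeval !mulr_sumr; apply: eq_bigr => z _; rewrite -!scalerAr.
have [card_z|/f0->] := eqVneq #|z| d; last by rewrite !scale0r.
congr (_ *: _).
have -> : \prod_(i in z) ((if i \in S then r else 0) + p) =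
    (p + r) ^+ #|z :&: S| * p ^+ #|z :\: S|.
  rewrite (bigID (mem S)) /= -!prodr_const; congr (_ * _).
    by apply: eq_big => [i|i /andP[_ ->]]; rewrite ?inE // addrC.
  by apply: eq_big => [i|i /andP[_ /negPf->]]; rewrite ?inE 1?andbC // add0r.
have cU := cardsUI S z; have cI := cardsID S z.
have leU : (#|S :|: z| <= t)%N by rewrite -[leqRHS]card_ord max_card.
rewrite setIC in cU.
rewrite mulrCA -exprD [_ ^+ #|z :&: S| * _]mulrC mulrACA -!exprD.
by congr (_ ^+ _ * _ ^+ _); lia.
Qed.

End Evaluation.

(** Translating the indicator of S by -1 gives the point that is -1 on the complement and 0 on S. *)
Lemma subset_sumC S : subset_sum (~: S) = (-1) ^+ d * subset_sum S.
Proof.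
have := set_mpeval_translate (A := K^o) (fun i => if i \in S then 1 else 0) (-1).
rewrite set_mpeval_indicator expr1n => E.
have := set_mpeval_indicator (A := K^o) (~: S) (-1).
rewrite (_ : set_mpeval _ = subset_sum S *: (1 : K^o)).
  by rewrite /GRing.scale /= mulr1 => ->; rewrite mulrCA -expr2 sqrr_sign mulr1.
rewrite -E /set_mpeval; apply: eq_bigr => z _; congr (_ *: _).
by apply: eq_bigr => i _; rewrite inE; case: (i \in S); rewrite /= ?subrr ?add0r.
Qed.

Lemma subset_sum_bounds S : subset_sum S != 0 -> (d <= #|S| <= t - d)%N.
Proof.
move=> FS; have leS : (#|S| <= t)%N by rewrite -[leqRHS]card_ord max_card.
have leC : (d <= #|~: S|)%N.
  rewrite leqNgt; apply: contra FS => /subset_sum_small.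
  by rewrite subset_sumC => /eqP; rewrite mulf_eq0 signr_eq0.
have : (d <= #|S|)%N by rewrite leqNgt; apply: contra FS => /subset_sum_small->.
by move: leC; rewrite cardsCs setCK card_ord; lia.
Qed.

(** * The reduced enumerator and its transform *)

Section Enumerator.
Local Notation X := (@Xvar K).
Local Notation Y := (@Yvar K).
Implicit Types (a b : {set 'I_t} -> K).

(** This is the polynomial Z. Truncated subtraction in the exponents is harmless: [subset_sum]
    vanishes unless d <= |S| <= t - d. *)
Definition reduced_enum a : {mpoly K[2]} :=
  \sum_(S : {set 'I_t})
    (a S * subset_sum S) *: (X ^+ (t - d - #|S|) * Y ^+ (#|S| - d)).

Definition cumul a T : K := \sum_(S : {set 'I_t} | S \subset T) a S.

Lemma scale_subset_sum_exp c S (U V : {mpoly K[2]}) :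
  (U * V) ^+ d *
    ((c * subset_sum S) *: (U ^+ (t - d - #|S|) * V ^+ (#|S| - d))) =
  (c * subset_sum S) *: (U ^+ (t - #|S|) * V ^+ #|S|).
Proof.
have [->|/subset_sum_bounds /andP[leS geS]] := eqVneq (subset_sum S) 0.
  by rewrite mulr0 !scale0r mulr0.
by rewrite -scalerAr exprMn mulrACA -!exprD; congr (_ *: (_ ^+ _ * _ ^+ _)); lia.
Qed.

Lemma reduced_enumE a : (X * Y) ^+ d * reduced_enum a =
  \sum_(S : {set 'I_t}) (a S * subset_sum S) *: (X ^+ (t - #|S|) * Y ^+ #|S|).
Proof.
by rewrite mulr_sumr; apply: eq_bigr => S _; rewrite scale_subset_sum_exp.
Qed.

Lemma meval_neq0 (p : {mpoly K[2]}) (v : 'I_2 -> K) : p.@[v] != 0 -> p != 0.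
Proof. by apply: contraNneq => ->; rewrite meval0. Qed.

Lemma Xvar_neq0 : X != 0.
Proof. by apply: (@meval_neq0 _ (fun=> 1)); rewrite mevalXU oner_neq0. Qed.

Lemma Yvar_neq0 : Y != 0.
Proof. by apply: (@meval_neq0 _ (fun=> 1)); rewrite mevalXU oner_neq0. Qed.

Lemma XsubY_neq0 : X - Y != 0.
Proof.
apply: (@meval_neq0 _ (fun i => (i == 0 :> nat)%:R)).
by rewrite mevalB !mevalXU subr0 oner_neq0.
Qed.

Lemma reduced_enum_homog a : homog_int (t%:Z - (2 * d)%:Z) (reduced_enum a).
Proof.
have [le2d|gt2d] := leqP (2 * d) t; last first.
  rewrite /reduced_enum big1 => [|S _]; first by move=> m; rewrite msupp0.
  have [->|/subset_sum_bounds] := eqVneq (subset_sum S) 0; last lia.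
  by rewrite mulr0 scale0r.
suff /dhomogP hZ : reduced_enum a \is (t - 2 * d).-homog.
  by move=> m /hZ/= ->; lia.
apply: rpred_sum => S _.
have [->|/subset_sum_bounds leS] := eqVneq (subset_sum S) 0.
  by rewrite mulr0 scale0r rpred0.
apply: rpredZ.
rewrite (_ : (t - 2 * d = (t - d - #|S|) + (#|S| - d))%N); last lia.
have expX (i : 'I_2) k : ('X_i : {mpoly K[2]}) ^+ k \is k.-homog.
  by rewrite -[k in k.-homog]mul1n dhomogMn // dhomogX /= mdeg1.
by apply: dhomogM; apply: expX.
Qed.

(** After multiplication by the nonzero X^d Y^d (X - Y)^d, the coefficients of each a S agree by
    [sum_superset_subset_sum] with p = Y and r = X - Y, so that p + r = X. *)
Lemma reduced_enum_cumul a : reduced_enum a =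
  \sum_(T : {set 'I_t})
    (cumul a T * subset_sum T) *:
      ((X - Y) ^+ (t - d - #|T|) * Y ^+ (#|T| - d)).
Proof.
have XY_neq0 : X ^+ d * Y ^+ d * (X - Y) ^+ d != 0.
  by rewrite !mulf_neq0 ?expf_neq0 ?Xvar_neq0 ?Yvar_neq0 ?XsubY_neq0.
apply: (mulfI XY_neq0).
transitivity ((X - Y) ^+ d *
    \sum_(S : {set 'I_t}) (a S * subset_sum S) *: (X ^+ (t - #|S|) * Y ^+ #|S|)).
  by rewrite -reduced_enumE exprMn mulrA; congr (_ * _); apply: mulrC.
transitivity (X ^+ d * \sum_(T : {set 'I_t})
    (cumul a T * subset_sum T) *: ((X - Y) ^+ (t - #|T|) * Y ^+ #|T|)); last first.
  rewrite -!mulrA; congr (_ * _); rewrite mulrA -exprMn [Y * _]mulrC mulr_sumr.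
  by apply: eq_bigr => T _; rewrite scale_subset_sum_exp.
under [in RHS]eq_bigr do rewrite /cumul mulr_suml scaler_suml.
rewrite (exchange_big_dep predT) //= !mulr_sumr; apply: eq_bigr => S _.
have := sum_superset_subset_sum S Y (X - Y); rewrite [Y + _]addrC subrK => E.
transitivity (a S *: (X ^+ d * \sum_(T : {set 'I_t} | S \subset T)
    subset_sum T *: (Y ^+ #|T| * (X - Y) ^+ (t - #|T|)))).
  rewrite E scalerA -scalerAr; congr (_ *: _).
  by rewrite [RHS]mulrC [Y ^+ _ * _]mulrC.
rewrite scalerAr scaler_sumr; congr (_ * _); apply: eq_bigr => T _.
by rewrite scalerA [Y ^+ _ * _]mulrC.
Qed.

(** The substitution sends X - Y to q Y and Y to X - Y, so it exchanges the two factors of each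
    term, as complementing T does. The sign comes from [subset_sumC]. *)
Lemma reduced_enum_macwilliams a b (q c : K) : c != 0 ->
    (forall T, c * cumul b T = q ^+ #|T| * cumul a (~: T)) ->
  reduced_enum b = ((-1) ^+ d * (q ^+ d / c)) *:
    (reduced_enum a \mPo [tuple X + (q - 1) *: Y; X - Y]).
Proof.
move=> c_neq0 abT; rewrite !reduced_enum_cumul (reindex_inj (@setC_inj _)) /=.
rewrite [_ \mPo _]raddf_sum scaler_sumr /=; apply: eq_bigr => T _.
rewrite comp_mpolyZ !(rmorphM, rmorphXn, rmorphB) /= !comp_mpolyXU /= subset_sumC.
have -> : X + (q - 1) *: Y - (X - Y) = q *: Y.
  by rewrite scalerBl scale1r opprB addrC addrA [Y - X + X]subrK addrC subrK.
have [->|/subset_sum_bounds leT] := eqVneq (subset_sum T) 0.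
  by rewrite !mulr0 !scale0r scaler0.
have [e1 e2 e3] : [/\ t - #|T| - d = t - d - #|T|,
    t - d - (t - #|T|) = #|T| - d & t - #|T| = d + (t - d - #|T|)]%N.
  by split; lia.
have cC : #|~: T| = (t - #|T|)%N by rewrite cardsCs setCK card_ord.
rewrite exprZn -scalerAl !scalerA cC; congr (_ *: _); last first.
  by rewrite mulrC; congr (_ ^+ _ * _ ^+ _).
have -> : cumul b (~: T) = q ^+ d * q ^+ (t - d - #|T|) * cumul a T / c.
  apply: (mulfI c_neq0); rewrite abT setCK cC mulrCA mulfV // mulr1 -exprD.
  by congr (_ ^+ _ * _).
by field.
Qed.

End Enumerator.

End HarmonicFunctions.

(** * Coordinates on the orbits *)

Section OrbitCoordinates.
Variables (R : finUnitRingType) (n t : nat) (H : {group 'S_n}).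
Variable alpha : 'I_t -> 'I_n.
Hypothesis card_H_unit : (#|H|%:R : R) \is a GRing.unit.
Hypothesis alpha_orbits : orbit_representatives H alpha.
Implicit Types (v w : 'rV[R]_n) (c b : 'rV[R]_t).

Let orb i := orbit 'P%act H (alpha i).

Lemma orb_sub i j k : j \in orb i -> j \in orb k -> i = k.
Proof.
have [alpha_inj _] := alpha_orbits => ji jk; apply: alpha_inj.
by rewrite -(orbit_eqP ji) -(orbit_eqP jk).
Qed.

Lemma orbit_index_exists j : exists i, j \in orb i.
Proof. by case: alpha_orbits => _; apply. Qed.

Definition orbit_index j : 'I_t := xchoose (orbit_index_exists j).

Lemma mem_orb j i : (j \in orb i) = (orbit_index j == i).
Proof.
have jP := xchooseP (orbit_index_exists j).
by apply/idP/eqP => [ji|<-//]; apply: orb_sub jP ji.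
Qed.

Lemma orbit_indexK : cancel alpha orbit_index.
Proof. by move=> i; apply/eqP; rewrite -mem_orb orbit_refl. Qed.

Lemma orbit_index_perm h j : h \in H -> orbit_index (h j) = orbit_index j.
Proof.
move=> Hh; apply/eqP; rewrite -mem_orb.
by rewrite -[h j]/('P%act j h) orbit_actr // mem_orb.
Qed.

(* The inverse of [hcoef], on row vectors. *)
Definition orbit_row c : 'rV[R]_n := \row_j c 0 (orbit_index j).

Lemma orbit_rowE c : orbit_row c = \sum_i c 0 i *: orbit_vec R H alpha i.
Proof.
apply/rowP => j; rewrite mxE summxE (bigD1 (orbit_index j)) //= big1 => [|i ne].
  by rewrite !mxE mem_orb eqxx mulr1 addr0.
by rewrite !mxE mem_orb eq_sym (negPf ne) mulr0.
Qed.

Lemma orbit_row_inj : injective orbit_row.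
Proof.
move=> c b /rowP E; apply/rowP => i.
by have := E (alpha i); rewrite !mxE orbit_indexK.
Qed.

Lemma hcoef_orbit_row c : hcoef H alpha (orbit_row c) = [ffun i => c 0 i].
Proof.
rewrite /hcoef; case: pickP => [c' /eqP E|/(_ [ffun i => c 0 i])] /=; last first.
  by rewrite orbit_rowE; under eq_bigr do rewrite ffunE; rewrite eqxx.
apply/ffunP => i; rewrite ffunE.
have : orbit_row c = orbit_row (\row_i c' i).
  by rewrite E orbit_rowE; apply: eq_bigr => k _; rewrite mxE.
by move/orbit_row_inj->; rewrite mxE.
Qed.

Lemma hsupp_orbit_row c : hsupp H alpha (orbit_row c) = row_supp c.
Proof. by apply/setP => i; rewrite !inE hcoef_orbit_row ffunE. Qed.

Lemma vact_orbit_row h c : h \in H -> vact (orbit_row c) h = orbit_row c.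
Proof.
by move=> Hh; apply/rowP => j; rewrite !mxE orbit_index_perm ?groupV.
Qed.

Lemma theta_orbit_row c : theta H (orbit_row c) = orbit_row c.
Proof.
rewrite /theta (eq_bigr (fun=> orbit_row c)) => [|h Hh]; last first.
  exact: vact_orbit_row.
by rewrite sumr_const -scaler_nat scalerA mulVr // scale1r.
Qed.

Lemma thetaE v j : theta H v 0 j = #|H|%:R^-1 * \sum_(h in H) v 0 (h j).
Proof.
rewrite mxE summxE; congr (_ * _); rewrite (reindex_inj invg_inj) /=.
by apply: eq_big => [h|h _]; rewrite ?groupV // !mxE invgK.
Qed.

Lemma theta_orbit_values v :
  theta H v = orbit_row (\row_i theta H v 0 (alpha i)).
Proof.
apply/rowP => j; rewrite [RHS]mxE [RHS]mxE !thetaE.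
have : j \in orb (orbit_index j) by rewrite mem_orb.
case/orbitP => k Hk def_j; rewrite -[in LHS]def_j; congr (_ * _).
(* Averages at two points of one orbit agree by translation in H. *)
rewrite [RHS](reindex_inj (mulgI k)) /=; apply: eq_big => [h|h _].
  by rewrite groupMl.
by rewrite permM.
Qed.

Lemma in_Vtheta v : reflect (exists c, v = orbit_row c) (v \in Vtheta R H).
Proof.
apply: (iffP imsetP) => [[w _ ->]|[c ->]].
  by exists (\row_i theta H w 0 (alpha i)); apply: theta_orbit_values.
by exists (orbit_row c); rewrite ?theta_orbit_row.
Qed.

Lemma Vtheta_imset : Vtheta R H = orbit_row @: [set: 'rV[R]_t].
Proof.
by apply/setP => v; apply/in_Vtheta/imsetP => [[c ->]|[c _ ->]]; exists c.
Qed.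

Definition orbit_card i : nat := #|orb i|.

(** An orbit length divides |H|, and an integer dividing a unit of R is a unit. This makes the orbit
    length matrix invertible. *)
Lemma orbit_card_unit i : ((orbit_card i)%:R : R) \is a GRing.unit.
Proof.
have /dvdnP[k def_H] : (orbit_card i %| #|H|)%N by apply: dvdn_orbit.
move: card_H_unit; rewrite def_H natrM unitrM_comm => [/andP[]//|].
exact: commr_nat.
Qed.

(** Each orbit contributes one product repeated as often as the orbit has points; this is the source
    of the orbit length matrix. *)
Lemma form_orbit_row c b :
  Defs.form (orbit_row c) (orbit_row b) =
    Defs.form c (\row_i (b 0 i * (orbit_card i)%:R)).
Proof.
rewrite /Defs.form (partition_big orbit_index predT) //=; apply: eq_bigr => i _.
rewrite (eq_bigr (fun=> c 0 i * b 0 i)) => [|j /eqP <-]; last by rewrite !mxE.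
rewrite mxE mulrA mulr_natr sumr_const; congr (_ *+ _).
by apply: eq_card => j; rewrite mem_orb.
Qed.

Lemma orbit_row_length_mx b :
  orbit_row b *m orbit_length_mx R H =
    orbit_row (\row_i (b 0 i * (orbit_card i)%:R)).
Proof.
rewrite /orbit_length_mx mul_mx_diag; apply/rowP => j; rewrite !mxE.
have ji : j \in orb (orbit_index j) by rewrite mem_orb.
by rewrite (orbit_eqP ji).
Qed.

Lemma form_vact v w h : Defs.form (vact v h) (vact w h) = Defs.form v w.
Proof.
rewrite /Defs.form [RHS](reindex_inj (@perm_inj _ h^-1)%g) /=.
by apply: eq_bigr => j _; rewrite !mxE.
Qed.

(** Elements of H preserve the form and fix [orbit_row c], so all the averaged terms are equal. *)
Lemma form_theta v c :
  Defs.form (theta H v) (orbit_row c) = Defs.form v (orbit_row c).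
Proof.
have formDl (u w x : 'rV[R]_n) :
    Defs.form (u + w) x = Defs.form u x + Defs.form w x.
  by have := form_linearl 1 u w x; rewrite scale1r mul1r.
rewrite /theta -[_ *: _]addr0 form_linearl form0l addr0.
rewrite (big_morph (fun u => Defs.form u _) (fun u w => formDl u w _) (form0l _)).
rewrite (eq_bigr (fun=> Defs.form v (orbit_row c))) => [|h Hh]; last first.
  by rewrite -[in LHS](vact_orbit_row c Hh) form_vact.
by rewrite sumr_const -[Defs.form _ _ *+ _]mulr_natl mulKr.
Qed.

Section Codes.
Variables (G : {group 'S_n}) (C : {set 'rV[R]_n}).
Hypothesis H_sub_G : H \subset G.
Hypothesis C_code : left_code G C.

Definition theta_coords : {set 'rV[R]_t} :=
  [set c | orbit_row c \in [set theta H v | v in C]].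

Lemma theta_code_sub v : v \in C -> theta H v \in C.
Proof.
have [[C0 CZ] CG] := C_code => Cv.
rewrite /theta -[_ *: _]addr0 CZ //; apply: (big_ind (fun u => u \in C)) => //.
  by move=> u w Cu Cw; rewrite -[u]scale1r CZ.
by move=> h Hh; rewrite CG // (subsetP H_sub_G).
Qed.

(** [theta] maps C into itself and fixes every [orbit_row c], so the image of C is its intersection
    with [Vtheta]. *)
Lemma in_theta_coords c : (c \in theta_coords) = (orbit_row c \in C).
Proof.
rewrite inE; apply/imsetP/idP => [[v Cv ->]|Cc]; first exact: theta_code_sub.
by exists (orbit_row c); rewrite ?theta_orbit_row.
Qed.

Lemma theta_coords_submod : submod_closed theta_coords.
Proof.
have [[C0 CZ] _] := C_code.
have rowZ a c b : orbit_row (a *: c + b) = a *: orbit_row c + orbit_row b.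
  by apply/rowP => j; rewrite !mxE.
split=> [|a c b]; rewrite !in_theta_coords ?rowZ; last exact: CZ.
by rewrite (_ : orbit_row 0 = 0) //; apply/rowP => j; rewrite !mxE.
Qed.

Lemma theta_codeE : [set theta H v | v in C] = orbit_row @: theta_coords.
Proof.
apply/setP => v; apply/idP/imsetP => [Dv|[c]]; last by rewrite inE => Dc ->.
have /in_Vtheta[c def_v] : v \in Vtheta R H.
  by case/imsetP: Dv => w _ ->; apply: imset_f.
by exists c; rewrite // inE -def_v.
Qed.

Lemma theta_dual_sub v : v \in right_dual C -> theta H v \in right_dual C.
Proof.
have [_ CG] := C_code; move=> /in_right_dual Cv; apply/in_right_dual => u Cu.
have formDr w w' : Defs.form u (w + w') = Defs.form u w + Defs.form u w' :> R.
  have := formBr u w (- w'); rewrite opprK => ->; congr (_ + _).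
  by rewrite -[- w']sub0r formBr form0r sub0r opprK.
have formMn w k : Defs.form u (w *+ k) = Defs.form u w *+ k.
  by elim: k => [|k IHk]; rewrite ?form0r // !mulrS formDr IHk.
(* The left scalar 1/|H| sits in the second argument of the form; multiplying by |H| clears it using
   additivity alone. *)
apply: (mulrI card_H_unit); rewrite mulr0 mulr_natl -formMn -scaler_nat.
rewrite scalerA divrr // scale1r.
rewrite (big_morph (Defs.form u) formDr (form0r u)) big1 // => h Hh.
have -> : u = vact (vact u h^-1) h.
  by apply/rowP => j; rewrite !mxE invgK permKV.
rewrite form_vact; apply: Cv; apply: CG => //.
by rewrite groupV (subsetP H_sub_G).
Qed.

(** By [form_orbit_row], the orbit length matrix turns orthogonality in V into ordinary
    orthogonality of orbit coordinates. *)
Lemma theta_dualE :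
  [set theta H v *m orbit_length_mx R H | v in right_dual C] =
    orbit_row @: right_dual theta_coords.
Proof.
apply/setP => u.
apply/imsetP/imsetP => [[v Cv ->]|[w /in_right_dual Cw ->]].
  have /in_Vtheta[b def_b] : theta H v \in Vtheta R H by apply: imset_f.
  rewrite def_b orbit_row_length_mx.
  set c := (X in orbit_row X); exists c => //; apply/in_right_dual => b'.
  rewrite in_theta_coords => Cb'; rewrite -form_orbit_row -def_b.
  exact: (in_right_dual _ _ (theta_dual_sub Cv)).
(* Dividing by the orbit lengths gives the preimage under the orbit length matrix. *)
pose b := \row_i (w 0 i / (orbit_card i)%:R).
have bw : \row_i (b 0 i * (orbit_card i)%:R) = w.
  by apply/rowP => i; rewrite !mxE divrK ?orbit_card_unit.
exists (orbit_row b); last by rewrite theta_orbit_row orbit_row_length_mx bw.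
apply/in_right_dual => v Cv; rewrite -form_theta.
have /in_Vtheta[c def_c] : theta H v \in Vtheta R H by apply: imset_f.
rewrite def_c form_orbit_row bw; apply: Cw.
by rewrite in_theta_coords -def_c theta_code_sub.
Qed.

End Codes.

End OrbitCoordinates.

(** * Harmonic weight enumerators *)

Section HarmonicEnumerators.
Variables (K : realType) (R : finUnitRingType) (n t d : nat) (H : {group 'S_n}).
Variables (alpha : 'I_t -> 'I_n) (f : {ffun {set 'I_t} -> K}).
Hypothesis card_H_unit : (#|H|%:R : R) \is a GRing.unit.
Hypothesis alpha_orbits : orbit_representatives H alpha.
Hypothesis f_harm : Harm d f.
Implicit Type (D : {set 'rV[R]_t}).

Local Notation orow := (@orbit_row R _ _ _ _ alpha_orbits).

(** Each d-set z is the support of exactly (q - 1)^d words, and f vanishes on sets of other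
    sizes. *)
Lemma ftilde_orbit_row (c : 'rV[R]_t) :
  ftilde H alpha d f (orow c) = (#|R|.-1 ^ d)%:R * subset_sum f (row_supp c).
Proof.
have [f0 _] := f_harm.
rewrite /ftilde (Vtheta_imset card_H_unit alpha_orbits).
rewrite big_imset_cond /=; last first.
  by move=> u v _ _; apply: orbit_row_inj.
transitivity (\sum_(b : 'rV[R]_t | row_supp b \subset row_supp c)
                f (row_supp b)).
  rewrite [RHS](bigID (fun b => #|row_supp b| == d)) /=.
  rewrite [X in _ + X]big1 ?addr0 => [|b /andP[_ /f0//]].
  apply: eq_big => b; rewrite /hwt !hsupp_orbit_row // inE /=.
  exact: andbC.
rewrite (partition_big (@row_supp R t) (fun z => z \subset row_supp c)) //=.
rewrite mulr_sumr; apply: eq_bigr => z zc.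
rewrite (eq_bigr (fun=> f z)) => [|b /andP[_ /eqP->]] //.
rewrite sumr_const -[f z *+ _]mulr_natl.
have [<-|/f0->] := eqVneq #|z| d; last by rewrite !mulr0.
rewrite -card_row_supp; congr (_%:R * _); apply: eq_card => b.
by rewrite !inE unfold_in /=; case: eqP => [->|]; rewrite ?zc ?andbF.
Qed.

(** The factor (q - 1)^d of [ftilde] is absorbed here. *)
Definition supp_count D S : K :=
  (#|R|.-1 ^ d)%:R * #|[set u in D | row_supp u == S]|%:R.

Lemma cumul_supp_count D T : cumul (supp_count D) T =
  (#|R|.-1 ^ d)%:R * #|[set u in D | row_supp u \subset T]|%:R.
Proof.
rewrite /cumul /supp_count -mulr_sumr -natr_sum; congr (_ * _%:R).
rewrite -sum1_card.
rewrite (partition_big (@row_supp R t) (fun S => S \subset T)) /=; last first.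
  by move=> u; rewrite inE => /andP[].
apply: eq_bigr => S ST; rewrite sum1_card; apply: eq_card => u.
rewrite [RHS]inE unfold_in /= inE -andbA.
rewrite -[LHS]/(u \in [set u in D | row_supp u == S]) inE.
by case: eqP => [->|]; rewrite ?ST ?andbF.
Qed.

Lemma harmonic_enum_orbit_row D :
  harmonic_enum H alpha d f (orow @: D) =
    (Xvar * Yvar) ^+ d * reduced_enum d f (supp_count D).
Proof.
rewrite reduced_enumE // /harmonic_enum big_imset /=; last first.
  by move=> u v _ _; apply: orbit_row_inj.
rewrite (partition_big (@row_supp R t) predT) //=; apply: eq_bigr => S _.
rewrite (eq_bigr (fun=> ((#|R|.-1 ^ d)%:R * subset_sum f S) *:
           (Xvar ^+ (t - #|S|) * Yvar ^+ #|S|))) => [|u /andP[_ /eqP<-]]; last first.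
  by rewrite ftilde_orbit_row /hwt hsupp_orbit_row.
rewrite sumr_const scalerMnl -[_ * _ *+ _]mulr_natr /supp_count mulrAC.
congr ((_ * _%:R * _) *: _); apply: eq_card => u.
by rewrite !inE unfold_in.
Qed.

End HarmonicEnumerators.

Theorem theorem3p6 (K : realType) (R : finUnitRingType) (n t d : nat)
    (G H : {group 'S_n}) (alpha : 'I_t -> 'I_n)
    (f : {ffun {set 'I_t} -> K}) (C : {set 'rV[R]_n})
    (R_frobenius : frobenius_ring R)
    (H_sub_G : H \subset G)
    (card_H_unit : (#|H|%:R : R) \is a GRing.unit)
    (alpha_orbits : orbit_representatives H alpha)
    (d_le_t : (d <= t)%N)
    (f_harm : Harm d f)
    (C_code : left_code G C) :
  let D1 := [set theta H v | v in C] in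
  let D2 := [set theta H v *m orbit_length_mx R H | v in right_dual C] in
  exists Z1 Z2 : {mpoly K[2]},
    [/\ harmonic_enum H alpha d f D1 = (Xvar * Yvar) ^+ d * Z1
          /\ homog_int (t%:Z - (2 * d)%:Z) Z1,
        harmonic_enum H alpha d f D2 = (Xvar * Yvar) ^+ d * Z2
          /\ homog_int (t%:Z - (2 * d)%:Z) Z2
      & Z2 = ((-1) ^+ d * (#|R|%:R ^+ d / #|D1|%:R)) *:
               (Z1 \mPo [tuple Xvar + (#|R|%:R - 1) *: Yvar; Xvar - Yvar])].
Proof.
move=> D1 D2; have [_ frobR] := R_frobenius.
set P := theta_coords alpha_orbits C.
have smP : submod_closed P :=
  theta_coords_submod card_H_unit alpha_orbits H_sub_G C_code.
have D1E : D1 = orbit_row (R := R) alpha_orbits @: P by apply: theta_codeE.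
have D2E : D2 = orbit_row (R := R) alpha_orbits @: right_dual P.
  exact: theta_dualE H_sub_G C_code.
exists (reduced_enum d f (supp_count K d P)).
exists (reduced_enum d f (supp_count K d (right_dual P))).
split.
- rewrite D1E harmonic_enum_orbit_row //.
  by split=> //; apply: reduced_enum_homog.
- rewrite D2E harmonic_enum_orbit_row //.
  by split=> //; apply: reduced_enum_homog.
have -> : #|D1| = #|P| by rewrite D1E card_imset //; apply: orbit_row_inj.
apply: reduced_enum_macwilliams => // [|T].
  by rewrite pnatr_eq0 -lt0n; apply/card_gt0P; exists 0; case: smP.
(* Without the common factor (q - 1)^d this is the count of words of the dual code supported in
   T. *)
rewrite !cumul_supp_count mulrCA [RHS]mulrCA; congr (_ * _).
by rewrite -natrX -!natrM card_shortened_dual.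
Qed.
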